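(* Let $(\mathcal{M},J)$ be an almost complex (resp. almost para-complex) manifold. Then its tangent bundle $T\mathcal{M}$ admits a canonical almost complex (resp. almost para-complex) structure $\tilde J$. Furthermore, if $J$ is complex (resp. para-complex), so is $\tilde J$.
   Context: An almost complex (resp. almost para-complex) structure on a manifold is a $(1,1)$-tensor $J$ with $J^2=-\mathrm{Id}$ (resp. $J^2=\mathrm{Id}$ with $\pm1$-eigenbundles of equal rank); a manifold endowed with such a structure is called an almost complex (resp. almost para-complex) manifold. The structure is called complex (resp. para-complex) if it is integrable, i.e. around each point there is a local chart in which the matrix of $J$ is constant. The structure $\tilde J$ is a $(1,1)$-tensor on the total space of $T\mathcal{M}$, regarded as a manifold; ''canonical'' means that it is determined by $J$ independently of the choice of local coordinates on $\mathcal{M}$. *)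

(* Defs.v *)
(* Tangent vectors are row vectors, and linear maps act on them on the right:
   'd f x v = v *m 'J f x, and a (1,1)-tensor with component matrix A in a chart
   sends the vector with components v to the one with components v *m A. *)
From HB Require Import structures.
From mathcomp Require Import all_boot all_order all_algebra.
From mathcomp Require Import boolp classical_sets functions cardinality reals.
From mathcomp Require Import interval_inference topology normedtype landau derive.
Set Implicit Arguments.
Unset Strict Implicit.
Unset Printing Implicit Defensive.
Import Order.TTheory GRing.Theory Num.Theory.
Import numFieldNormedType.Exports.
Local Open Scope classical_set_scope.
Local Open Scope ring_scope.

(* Class C^k on an open set U; differentiability being part of C^(k+1), this is
   the usual recursion on the directional derivatives. *)
Fixpoint Ck (R : realType) (V W : normedModType R) (k : nat) (U : set V)
    (f : V -> W) : Prop :=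
  match k with
  | 0%N => forall x, U x -> {for x, continuous f}
  | k'.+1 => (forall x, U x -> differentiable f x) /\
            (forall v, Ck k' U ('D_v f))
  end.

Definition smooth (R : realType) (V W : normedModType R) (U : set V)
    (f : V -> W) : Prop := forall k, Ck k U f.

Section SmoothTheory.
Context {R : realType}.

Lemma near_eq_differentiable (V W : normedModType R) (f g : V -> W) x :
  {near x, f =1 g} -> differentiable f x -> differentiable g x.
Proof.
move=> fg /diff_locallyP [fc fo].
have go : g \o shift x = cst (g x) + 'd f x +o_ 0 id.
  apply/eqaddoP => e e0; have /eqaddoP/(_ _ e0) := fo.
  have fg0 : \forall h \near 0, f (h + x) = g (h + x).
    have : \forall h \near 0, ((fun y => f y = g y) \o shift (x - 0)) h.
      by rewrite -near_shift.
    by apply: filterS => h /=; rewrite subr0.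
  apply: filterS2 fg0 => h fgh /=.
  by rewrite !fctE /= fgh (nbhs_singleton fg).
by apply/diff_locallyP; rewrite (diff_unique fc go).
Qed.

Lemma open_near_eq (V W : normedModType R) (U : set V) (f g : V -> W) x :
  open U -> (forall y, U y -> f y = g y) -> U x -> {near x, f =1 g}.
Proof. by move=> oU fg Ux; apply: filterS (open_nbhs_nbhs (conj oU Ux)). Qed.

Lemma Ck_eq (V W : normedModType R) k (U : set V) (f g : V -> W) :
  open U -> (forall x, U x -> f x = g x) -> Ck k U f -> Ck k U g.
Proof.
move=> oU; elim: k f g => [|k IH] f g fg /=.
  move=> cf x Ux; rewrite /prop_for /continuous_at -fg //.
  apply: cvg_trans (cf x Ux); apply: near_eq_cvg.
  exact: open_near_eq oU fg Ux.
move=> [df Df]; split.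
  by move=> x Ux; apply: near_eq_differentiable (df x Ux); exact: open_near_eq oU fg Ux.
move=> v; apply: IH (Df v) => x Ux.
by apply: near_eq_derive; exact: open_near_eq oU fg Ux.
Qed.

Lemma Ck_cst (V W : normedModType R) k (U : set V) (a : W) : Ck k U (fun _ : V => a).
Proof.
elim: k a => [|k IH] a /=; first by move=> x _; exact: cst_continuous.
split => [x _|v]; first exact: differentiable_cst.
have -> : 'D_v (fun _ : V => a) = fun _ => 0 by apply/funext => x; exact: derive_cst.
exact: IH.
Qed.

Lemma CkD (V W : normedModType R) k (U : set V) (f g : V -> W) :
  open U -> Ck k U f -> Ck k U g -> Ck k U (fun x => f x + g x).
Proof.
move=> oU; elim: k f g => [|k IH] f g /=.
  by move=> cf cg x Ux; apply: continuousD; [exact: cf|exact: cg].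
move=> [df Df] [dg Dg]; split.
  by move=> x Ux; apply: differentiableD; [exact: df|exact: dg].
move=> v; apply: Ck_eq (IH _ _ (Df v) (Dg v)) => // x Ux.
by rewrite -deriveD //; apply: diff_derivable; [exact: df|exact: dg].
Qed.

Lemma Ck_sum (V W : normedModType R) k (U : set V) n (f : 'I_n -> V -> W) :
  open U -> (forall i, Ck k U (f i)) -> Ck k U (fun x => \sum_i f i x).
Proof.
move=> oU; elim: n f => [|n IH] f cf.
  have -> : (fun x => \sum_i f i x) = fun _ => 0 by apply/funext => x; rewrite big_ord0.
  exact: Ck_cst.
have -> : (fun x => \sum_i f i x) = fun x => f ord0 x + \sum_i f (lift ord0 i) x.
  by apply/funext => x; rewrite big_ord_recl.
by apply: CkD => //; apply: IH.
Qed.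

Lemma Ck_linl (V W Z : normedModType R) k (U : set V) (f : V -> W)
    (L : {linear W -> Z}) :
  open U -> continuous L -> Ck k U f -> Ck k U (fun x => L (f x)).
Proof.
move=> oU cL; elim: k f => [|k IH] f /=.
  move=> cf x Ux; apply: continuous_comp; [exact: cf|exact: cL].
move=> [df Df]; split.
  move=> x Ux; apply: differentiable_comp; [exact: df|exact: linear_differentiable].
move=> v; apply: Ck_eq (IH _ (Df v)) => // x Ux.
have dL y : differentiable L y by exact: linear_differentiable.
rewrite (deriveE v (df x Ux)) (deriveE v (differentiable_comp (df x Ux) (dL _))).
by rewrite (diff_comp (df x Ux) (dL _)) /= diff_lin.
Qed.

Lemma Ck_linr (V W Z : normedModType R) k (U : set W) (f : W -> Z)
    (L : {linear V -> W}) :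
  open U -> continuous L -> Ck k U f -> Ck k (L @^-1` U) (fun x => f (L x)).
Proof.
move=> oU cL; have oV : open (L @^-1` U) by apply: open_comp => // x _; exact: cL.
elim: k f => [|k IH] f /=.
  move=> cf x Ux; apply: continuous_comp; [exact: cL|exact: cf].
move=> [df Df]; split.
  move=> x Ux; apply: differentiable_comp; [exact: linear_differentiable|exact: df].
move=> v; apply: Ck_eq (IH _ (Df (L v))) => // x Ux.
have dL y : differentiable L y by exact: linear_differentiable.
rewrite (deriveE _ (df _ Ux)) (deriveE v (differentiable_comp (dL x) (df _ Ux))).
by rewrite (diff_comp (dL x) (df _ Ux)) /= diff_lin.
Qed.

Lemma CkS (V W : normedModType R) k (U : set V) (f : V -> W) :
  Ck k.+1 U f -> Ck k U f.
Proof.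
elim: k f => [|k IH] f.
  by move=> [df _] x Ux; apply: differentiable_continuous; exact: df.
move=> [df Df]; split => // v; apply: IH; exact: Df.
Qed.

Lemma CkM (V : normedModType R) k (U : set V) (f g : V -> R) :
  open U -> Ck k U f -> Ck k U g -> Ck k U (fun x => f x * g x).
Proof.
move=> oU; elim: k f g => [|k IH] f g.
  by move=> cf cg x Ux; apply: continuousM; [exact: cf|exact: cg].
move=> cf cg; have [df Df] := cf; have [dg Dg] := cg; split.
  by move=> x Ux; apply: differentiableM; [exact: df|exact: dg].
move=> v.
have h := CkD oU (IH _ _ (CkS cf) (Dg v)) (IH _ _ (CkS cg) (Df v)).
apply: Ck_eq h => // x Ux.
have -> : (fun x => f x * g x) = f * g by [].
by rewrite deriveM //; apply: diff_derivable; [exact: df|exact: dg].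
Qed.

Lemma lin_cont_mx m (W : normedModType R) (L : {linear 'rV[R]_m -> W}) : continuous L.
Proof.
have -> : (L : 'rV[R]_m -> W) = fun x => \sum_i (x ord0 i *: L (delta_mx ord0 i)).
  apply/funext => x; rewrite {1}[x]row_sum_delta linear_sum.
  by apply: eq_bigr => i _; rewrite linearZ.
suff : Ck 0 setT (fun x : 'rV[R]_m => \sum_i (x ord0 i *: L (delta_mx ord0 i))).
  by move=> c x; exact: c.
apply: Ck_sum => [|i x _]; first exact: openT.
have h : continuous (fun x : 'rV[R]_m => x ord0 i) by exact: coord_continuous.
exact: (cvgZr_tmp (a := _) (h x)).
Qed.



Lemma CkZl (V W : normedModType R) k (U : set V) (s : V -> R) (a : W) :
  open U -> Ck k U s -> Ck k U (fun x => s x *: a).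
Proof.
move=> oU; elim: k s => [|k IH] s /=.
  move=> cs x Ux; exact: (cvgZr_tmp (a := _) (cs x Ux)).
move=> [ds Ds]; split; first by move=> x Ux; apply: differentiableZl; exact: ds.
move=> v; apply: Ck_eq (IH _ (Ds v)) => // x Ux.
rewrite (deriveE v (ds x Ux)) (deriveE v (differentiableZl a (ds x Ux))).
by rewrite diffZl //; exact: ds.
Qed.

Lemma Ck_coord (V : normedModType R) k (U : set V) m n (f : V -> 'M[R]_(m, n)) i j :
  open U -> Ck k U f -> Ck k U (fun x => f x i j).
Proof.
move=> oU; elim: k f => [|k IH] f /=.
  move=> cf x Ux.
  exact: (@continuous_comp _ _ _ f (fun M : 'M[R]_(m, n) => M i j) x (cf x Ux)
    (@coord_continuous _ _ _ i j _)).
move=> [df Df]; split.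
  by move=> x Ux; exact: (differentiable_comp (df x Ux) (differentiable_coord _ i j)).
move=> v; apply: Ck_eq (IH _ (Df v)) => // x Ux.
by rewrite derive_mx ?mxE //; apply: diff_derivable; exact: df.
Qed.

Lemma Ck_rowP (V : normedModType R) k (U : set V) n (f : V -> 'rV[R]_n) :
  open U -> (forall j, Ck k U (fun x => f x ord0 j)) -> Ck k U f.
Proof.
move=> oU cf.
have -> : f = fun x => \sum_j f x ord0 j *: delta_mx ord0 j.
  by apply/funext => x; exact: row_sum_delta.
by apply: Ck_sum => // j; apply: CkZl.
Qed.

Lemma Ck_lin (V W : normedModType R) k (U : set V) (L : {linear V -> W}) :
  open U -> continuous L -> Ck k U L.
Proof.
move=> oU cL; apply: (@Ck_linl V V W k U id) => //.
case: k => [|k]; first by move=> x _; exact: cvg_id.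
split => [x _|v]; first exact: ex_diff.
have -> : 'D_v (@id V) = fun _ => v by apply/funext => x; exact: derive_id.
exact: Ck_cst.
Qed.

Lemma jacobian_coord m n (f : 'rV[R]_m -> 'rV[R]_n) x i j :
  differentiable f x -> 'J f x i j = ('D_(delta_mx ord0 i) f x) ord0 j.
Proof. by move=> df; rewrite /jacobian mxE deriveE. Qed.

Lemma Ck_mulJ m n (U : set 'rV[R]_m) (f : 'rV[R]_m -> 'rV[R]_n) k :
  open U -> Ck k.+1 U f ->
  Ck k ([set y | U (lsubmx y)] : set 'rV[R]_(m + m))
    (fun y => rsubmx y *m 'J f (lsubmx y)).
Proof.
move=> oU [df Df].
have cl : continuous (lsubmx : 'rV[R]_(m + m) -> 'rV[R]_m) by exact: continuous_lsubmx.
have oU2 : open ([set y | U (lsubmx y)] : set 'rV[R]_(m + m)).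
  by apply: open_comp => // x _; exact: cl.
apply: Ck_rowP => // j.
apply: (@Ck_eq _ _ _ _ (fun y => \sum_i rsubmx y ord0 i *
   ('D_(delta_mx ord0 i) f (lsubmx y)) ord0 j)) => //.
  move=> y Uy; rewrite [RHS]mxE; apply: eq_bigr => i _.
  by rewrite jacobian_coord //; exact: df.
apply: Ck_sum => // i; apply: CkM => //.
  apply: Ck_coord => //; apply: Ck_lin => //; exact: continuous_rsubmx.
apply: (@Ck_coord _ _ _ 1 n (fun y => 'D_(delta_mx ord0 i) f (lsubmx y)) ord0 j) => //.
exact: (@Ck_linr _ _ _ _ U ('D_(delta_mx ord0 i) f) lsubmx oU cl (Df _)).
Qed.
End SmoothTheory.

(* cinv is the inverse of cmap; its values outside the image of cdom are
   irrelevant. *)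
Record chart (R : realType) (n : nat) (M : topologicalType) := Chart {
  cdom : set M;
  cmap : M -> 'rV[R]_n;
  cinv : 'rV[R]_n -> M;
  cdom_open : open cdom;
  cimg_open : open (cmap @` cdom);
  cmapK : forall p, cdom p -> cinv (cmap p) = p;
  cmap_continuous : forall p, cdom p -> {for p, continuous cmap};
  cinv_continuous : forall x, (cmap @` cdom) x -> {for x, continuous cinv} }.

(* The expression of f in the charts c and d, meaningful on the image under c of
   cdom c `&` f @^-1` cdom d. *)
Definition in_charts (R : realType) (m n : nat) (M N : topologicalType)
    (c : chart R m M) (d : chart R n N) (f : M -> N) : 'rV[R]_m -> 'rV[R]_n :=
  fun x => cmap d (f (cinv c x)).

Definition transition (R : realType) (n : nat) (M : topologicalType)
    (c d : chart R n M) : 'rV[R]_n -> 'rV[R]_n := in_charts c d id.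

Definition overlap (R : realType) (n : nat) (M : topologicalType)
    (c d : chart R n M) : set 'rV[R]_n := cmap c @` (cdom c `&` cdom d).

(* The atlas need not be maximal: see smooth_chart below. *)
Record manifold (R : realType) (n : nat) := Manifold {
  carrier :> topologicalType;
  carrier_hausdorff : hausdorff_space carrier;
  carrier_second_countable : @second_countable carrier;
  atlas_index : Type;
  atlas : atlas_index -> chart R n carrier;
  atlas_cover : forall p, exists i, cdom (atlas i) p;
  atlas_compatible : forall i j,
    smooth (overlap (atlas i) (atlas j)) (transition (atlas i) (atlas j)) }.

#[local] Opaque diff.

Section ChartTheory.
Context {R : realType}.

Lemma cinvK n (M : topologicalType) (c : chart R n M) x :
  (cmap c @` cdom c) x -> cmap c (cinv c x) = x.
Proof. by move=> [p cp <-]; rewrite cmapK. Qed.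

Lemma cinv_dom n (M : topologicalType) (c : chart R n M) x :
  (cmap c @` cdom c) x -> cdom c (cinv c x).
Proof. by move=> [p cp <-]; rewrite cmapK. Qed.

Lemma img_preimg n (M : topologicalType) (c : chart R n M) (A : set M) :
  cmap c @` (cdom c `&` A) = cmap c @` cdom c `&` cinv c @^-1` A.
Proof.
apply/seteqP; split => x.
  by move=> [p [cp Ap] <-]; split; [exists p|rewrite /= cmapK].
by move=> [[p cp <-]]; rewrite /= cmapK // => Ap; exists p.
Qed.

Lemma open_img n (M : topologicalType) (c : chart R n M) (A : set M) :
  open A -> open (cmap c @` (cdom c `&` A)).
Proof.
move=> oA; rewrite img_preimg openE => x [cx Ax].
apply: (@filterI _ (nbhs x) _ (cmap c @` cdom c) (cinv c @^-1` A)).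
  by apply: open_nbhs_nbhs; split => //; exact: cimg_open.
by apply: (cinv_continuous cx); apply: open_nbhs_nbhs; split.
Qed.

Lemma overlap_open n (M : topologicalType) (c d : chart R n M) : open (overlap c d).
Proof. apply: open_img; exact: cdom_open. Qed.

Lemma jacobian_comp m n p (f : 'rV[R]_m -> 'rV[R]_n) (g : 'rV[R]_n -> 'rV[R]_p) x :
  differentiable f x -> differentiable g (f x) ->
  'J (g \o f) x = 'J f x *m 'J g (f x).
Proof.
move=> df dg; rewrite /jacobian diff_comp //=.
by apply/row_matrixP => i; rewrite row_mul !rowE mul_rV_lin1 /= !mul_rV_lin1.
Qed.

Lemma near_eq_jacobian m n (f g : 'rV[R]_m -> 'rV[R]_n) x :
  {near x, f =1 g} -> differentiable f x -> 'J f x = 'J g x.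
Proof.
move=> fg df; have dg := near_eq_differentiable fg df.
have e : ('d f x : 'rV[R]_m -> 'rV[R]_n) = 'd g x.
  apply/funext => v.
  exact: (etrans (esym (deriveE v df)) (etrans (near_eq_derive v fg) (deriveE v dg))).
exact: (f_equal (@lin1_mx R m n) e).
Qed.

#[local] Opaque jacobian.

Lemma near_dom n (M N : topologicalType) (c : chart R n M) (f : M -> N) (A : set N) p :
  open A -> cdom c p -> {for p, continuous f} -> A (f p) ->
  \forall x \near cmap c p, (cmap c @` cdom c) x /\ A (f (cinv c x)).
Proof.
move=> oA cp cf Ap.
have ix : (cmap c @` cdom c) (cmap c p) by exists p.
apply: (@filterI _ (nbhs (cmap c p)) _ (cmap c @` cdom c)
  (cinv c @^-1` (f @^-1` A))).
  by apply: open_nbhs_nbhs; split => //; exact: cimg_open.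
have := cinv_continuous ix; rewrite /prop_for /continuous_at cmapK // => h.
by apply: h; apply: cf; apply: open_nbhs_nbhs; split; [exact: oA|exact: Ap].
Qed.

Lemma in_charts_comp m n q (M N P : topologicalType) (c : chart R m M)
    (d : chart R n N) (e : chart R q P) (f : M -> N) (g : N -> P) p :
  cdom c p -> cdom d (f p) -> {for p, continuous f} ->
  differentiable (in_charts c d f) (cmap c p) ->
  differentiable (in_charts d e g) (cmap d (f p)) ->
  'J (in_charts c e (g \o f)) (cmap c p) =
  'J (in_charts c d f) (cmap c p) *m 'J (in_charts d e g) (cmap d (f p)).
Proof.
move=> cp dp cf df dg.
have E : in_charts c d f (cmap c p) = cmap d (f p) by rewrite /in_charts cmapK.
have dg' : differentiable (in_charts d e g) (in_charts c d f (cmap c p)) by rewrite E.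
have := jacobian_comp df dg'; rewrite E => <-.
apply/esym/near_eq_jacobian; last exact: differentiable_comp.
have := near_dom (cdom_open d) cp cf dp; apply: filterS => x [cx dx].
by rewrite /in_charts /= cmapK.
Qed.

Lemma smooth_diff (V W : normedModType R) (U : set V) (f : V -> W) x :
  smooth U f -> U x -> differentiable f x.
Proof. by move=> /(_ 1%N) [df _]; exact: df. Qed.

Section Manifold.
Context {n : nat} (M : manifold R n).
Implicit Types i j k : atlas_index M.

Lemma transition_diff i j p : cdom (atlas i) p -> cdom (atlas j) p ->
  differentiable (transition (atlas i) (atlas j)) (cmap (atlas i) p).
Proof. by move=> ip jp; apply: smooth_diff (atlas_compatible i j) _; exists p. Qed.

Lemma jacobian_transition i j k p :
  cdom (atlas i) p -> cdom (atlas j) p -> cdom (atlas k) p ->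
  'J (transition (atlas i) (atlas k)) (cmap (atlas i) p) =
  'J (transition (atlas i) (atlas j)) (cmap (atlas i) p) *m
  'J (transition (atlas j) (atlas k)) (cmap (atlas j) p).
Proof.
move=> ip jp kp; apply: (@in_charts_comp _ _ _ M M M _ _ _ id id) => //.
- exact: (transition_diff ip jp).
- exact: (transition_diff jp kp).
Qed.

Lemma jacobian_id_transition i p : cdom (atlas i) p ->
  'J (transition (atlas i) (atlas i)) (cmap (atlas i) p) = 1%:M.
Proof.
move=> ip; rewrite -(@near_eq_jacobian _ _ id).
- apply/row_matrixP => a; rewrite !rowE mulmx1 mul_rV_lin1 /=.
  by rewrite diff_val.
- have ix : (cmap (atlas i) @` cdom (atlas i)) (cmap (atlas i) p) by exists p.
  have : nbhs (cmap (atlas i) p) (cmap (atlas i) @` cdom (atlas i)).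
    by apply: open_nbhs_nbhs; split => //; exact: cimg_open.
  apply: filterS => x hx.
  by rewrite /transition /in_charts cinvK.
- exact: ex_diff.
Qed.

End Manifold.
End ChartTheory.

(* A tangent vector at a point assigns to each chart around this point an element
   of R^n, these components being related by the Jacobian matrices of the
   transition maps. Setting the components to 0 in the charts whose domain
   misses the point makes this assignment unique. *)
Record tangent_vector (R : realType) (n : nat) (M : manifold R n) := TangentVector {
  foot : M;
  component : atlas_index M -> 'rV[R]_n;
  component_out : forall i, ~ cdom (atlas i) foot -> component i = 0;
  component_change : forall i j, cdom (atlas i) foot -> cdom (atlas j) foot ->
    component j =
    component i *m 'J (transition (atlas i) (atlas j)) (cmap (atlas i) foot) }.

HB.instance Definition _ (R : realType) (n : nat) (M : manifold R n) :=
  gen_eqMixin (tangent_vector M).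
HB.instance Definition _ (R : realType) (n : nat) (M : manifold R n) :=
  gen_choiceMixin (tangent_vector M).

Section TangentBundle.
Context {R : realType} {n : nat} (M : manifold R n).
Implicit Types (i j k : atlas_index M) (xi : tangent_vector M) (y : 'rV[R]_(n + n)).

Lemma tangent_vectorP xi zeta i :
  foot xi = foot zeta -> cdom (atlas i) (foot xi) ->
  component xi i = component zeta i ->
  xi = zeta.
Proof.
case: xi zeta => [p v o c] [q w o' c'] /= pq; subst q => ip vw.
have : v = w.
  apply/funext => j; have [jp|jp] := pselect (cdom (atlas j) p).
    by rewrite (c i j) // (c' i j) // vw.
  by rewrite o // o'.
by move=> ?; subst w; congr TangentVector; exact: Prop_irrelevance.
Qed.

(* tangent_of i p v is the tangent vector at p with components v in the chart i. *)
Section Make.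
Variables (i : atlas_index M) (p : M) (v : 'rV[R]_n).

Definition vector_comp j : 'rV[R]_n :=
  if `[< cdom (atlas i) p /\ cdom (atlas j) p >]
  then v *m 'J (transition (atlas i) (atlas j)) (cmap (atlas i) p) else 0.

Lemma vector_comp_out j : ~ cdom (atlas j) p -> vector_comp j = 0.
Proof. by rewrite /vector_comp => jp; case: asboolP => // -[]. Qed.

Lemma vector_comp_change j k : cdom (atlas j) p -> cdom (atlas k) p ->
  vector_comp k =
  vector_comp j *m 'J (transition (atlas j) (atlas k)) (cmap (atlas j) p).
Proof.
rewrite /vector_comp => jp kp.
case: asboolP => [[ip _]|nk]; case: asboolP => [[ip' _]|nj].
- by rewrite -mulmxA -jacobian_transition.
- by case: nj.
- by case: nk.
- by rewrite mul0mx.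
Qed.

Definition tangent_of : tangent_vector M :=
  TangentVector vector_comp_out vector_comp_change.

Lemma component_tangent_of : cdom (atlas i) p -> component tangent_of i = v.
Proof.
move=> ip; rewrite /= /vector_comp; case: asboolP => [_|[//]].
by rewrite jacobian_id_transition // mulmx1.
Qed.

End Make.

Definition tdom i : set (tangent_vector M) := [set xi | cdom (atlas i) (foot xi)].
Definition tmap i xi : 'rV[R]_(n + n) :=
  row_mx (cmap (atlas i) (foot xi)) (component xi i).
Definition tinv i y : tangent_vector M :=
  tangent_of i (cinv (atlas i) (lsubmx y)) (rsubmx y).

Lemma tmapK i xi : tdom i xi -> tinv i (tmap i xi) = xi.
Proof.
move=> ip; have fE : foot (tinv i (tmap i xi)) = foot xi by rewrite /= row_mxKl cmapK.
apply: (@tangent_vectorP _ _ i) => //; first by rewrite fE.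
by rewrite component_tangent_of /tmap ?row_mxKr ?row_mxKl ?cmapK.
Qed.

Lemma timgE i : tmap i @` tdom i =
  [set y | (cmap (atlas i) @` cdom (atlas i)) (lsubmx y)].
Proof.
apply/seteqP; split => [_ [xi ip <-]|y /= iy].
  by rewrite /= row_mxKl; exists (foot xi).
exists (tinv i y); first exact: cinv_dom.
by rewrite /tmap component_tangent_of ?cinvK ?hsubmxK //; exact: cinv_dom.
Qed.

Lemma timg_open i : open (tmap i @` tdom i).
Proof.
rewrite timgE; apply: open_comp; last exact: cimg_open.
by move=> y _; exact: continuous_lsubmx.
Qed.

(* The topology of the tangent bundle is the one for which the maps tmap i are
   homeomorphisms from open sets onto their images. *)
Definition topen (W : set (tangent_vector M)) : Prop :=
  forall i, open (tmap i @` tdom i `&` tinv i @^-1` W).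

Lemma topenT : topen setT.
Proof. by move=> i; rewrite preimage_setT setIT; exact: timg_open. Qed.

Lemma topenI : setI_closed topen.
Proof.
move=> A B oA oB i; rewrite preimage_setI -[X in X `&` _]setIid setIACA.
exact: openI.
Qed.

Lemma topen_bigU (I : Type) (F : I -> set (tangent_vector M)) :
  (forall a, topen (F a)) -> topen (\bigcup_a F a).
Proof.
move=> oF i; rewrite preimage_bigcup setI_bigcupr.
by apply: bigcup_open => a _; exact: oF.
Qed.

HB.instance Definition _ := isOpenTopological.Build (tangent_vector M)
  topenT topenI topen_bigU.
End TangentBundle.

Lemma rV_second_countable (R : realType) m : @second_countable 'rV[R]_m.
Proof.
pose b (qk : 'rV[rat]_m * nat) := ball (map_mx ratr qk.1 : 'rV[R]_m) qk.2.+1%:R^-1.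
exists (b @` setT).
  apply: sub_countable (card_image_le _ _) _; exact: countableP.
split; first by move=> _ [qk _ <-]; apply: ball_open; rewrite invr_gt0.
move=> x A /nbhs_ballP [e /= e0 eA].
have e20 : 0 < e / 2 by rewrite divr_gt0.
have [k ke] : exists k : nat, k.+1%:R^-1 < e / 2.
  have := near_infty_natSinv_lt (PosNum e20); exact: filter_ex.
have k0 : 0 < k.+1%:R^-1 :> R by rewrite invr_gt0.
have qP j : exists q : rat, ball (ratr q : R) k.+1%:R^-1 (x ord0 j).
  have lt : x ord0 j - k.+1%:R^-1 < x ord0 j + k.+1%:R^-1.
    by rewrite ltrD2l (lt_trans _ k0) // oppr_lt0.
  have [q] := rat_in_itvoo lt; rewrite in_itv /= => /andP[q1 q2]; exists q.
  by rewrite -ball_normE /= ltr_distl q1 q2.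
have [q qx] := choice qP.
have bx : b (\row_j q j, k) x.
  by split => // i j; rewrite !mxE !ord1; exact: qx.
exists (b (\row_j q j, k)); first by split => //; exists (\row_j q j, k).
move=> y yb; apply: eA; apply: (@le_ball _ _ _ (k.+1%:R^-1 + k.+1%:R^-1)).
  by rewrite [leRHS]splitr lerD // ltW.
exact: ball_triangle (ball_sym bx) yb.
Qed.

Lemma for_continuousP (S T : topologicalType) (f : S -> T) x :
  (forall B, open B -> B (f x) -> nbhs x (f @^-1` B)) -> {for x, continuous f}.
Proof.
move=> h A; rewrite nbhsE => -[B [oB Bfx] BA].
by apply: filterS (h B oB Bfx) => y /BA.
Qed.

Section TangentBundleTheory.
Context {R : realType} {n : nat} (M : manifold R n).
Implicit Types (i j k : atlas_index M) (xi : tangent_vector M) (y : 'rV[R]_(n + n)).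

Lemma open_tangentE (W : set (tangent_vector M)) : open W = topen W.
Proof. by []. Qed.

Lemma open_foot (A : set M) : open A -> open ((@foot _ _ M) @^-1` A).
Proof.
move=> oA; rewrite open_tangentE => i; rewrite timgE.
have -> : [set y : 'rV[R]_(n + n) | (cmap (atlas i) @` cdom (atlas i)) (lsubmx y)]
   `&` tinv i @^-1` (@foot _ _ M @^-1` A) =
   lsubmx @^-1` (cmap (atlas i) @` (cdom (atlas i) `&` A)) by rewrite img_preimg.
apply: open_comp; last exact: open_img.
by move=> y _; exact: continuous_lsubmx.
Qed.

Lemma foot_continuous : continuous (@foot _ _ M).
Proof. by apply/continuousP => A; exact: open_foot. Qed.

Lemma tdom_open i : open (@tdom _ _ M i).
Proof. exact: (open_foot (cdom_open (atlas i))). Qed.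

Lemma toverlapE i j : tmap i @` (tdom i `&` tdom j) =
  lsubmx @^-1` overlap (atlas i) (atlas j).
Proof.
apply/seteqP; split => [_ [xi [ip jp] <-]|y [p [ip jp] py]].
  by rewrite /= row_mxKl; exists (foot xi).
have iy : (tmap i @` @tdom _ _ M i) y by rewrite timgE /= -py; exists p.
case: iy => xi ixi yE; exists xi => //; split => //.
move: py; rewrite -yE /= row_mxKl => pE.
by rewrite /tdom /= -(cmapK ixi) -pE cmapK.
Qed.

Lemma toverlap_open i j : open (tmap i @` (@tdom _ _ M i `&` tdom j)).
Proof.
rewrite toverlapE; apply: open_comp; last exact: overlap_open.
by move=> y _; exact: continuous_lsubmx.
Qed.

Lemma ttransitionE i j y : (tmap i @` (@tdom _ _ M i `&` tdom j)) y ->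
  tmap j (tinv i y) =
  row_mx (transition (atlas i) (atlas j) (lsubmx y))
         (rsubmx y *m 'J (transition (atlas i) (atlas j)) (lsubmx y)).
Proof.
move=> [xi [ip jp] <-]; rewrite tmapK // /tmap row_mxKl row_mxKr.
by rewrite -component_change // /transition /in_charts cmapK.
Qed.

Lemma ttransition_smooth i j :
  smooth (tmap i @` (@tdom _ _ M i `&` tdom j)) (fun y => tmap j (tinv i y)).
Proof.
move=> k; set U := tmap i @` _.
have oU : open U by exact: toverlap_open.
have oV : open (overlap (atlas i) (atlas j)) by exact: overlap_open.
have cl : continuous (lsubmx : 'rV[R]_(n + n) -> 'rV[R]_n) by exact: continuous_lsubmx.
pose A : 'M[R]_(n, n + n) := row_mx 1%:M 0.
pose B : 'M[R]_(n, n + n) := row_mx 0 1%:M.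
have h y : U y ->
  mulmxr A (transition (atlas i) (atlas j) (lsubmx y)) +
  mulmxr B (rsubmx y *m 'J (transition (atlas i) (atlas j)) (lsubmx y)) =
  tmap j (tinv i y).
  move=> Uy; rewrite (ttransitionE Uy) /= !mul_mx_row !mulmx0 !mulmx1.
  by rewrite add_row_mx add0r addr0.
apply: Ck_eq h _ => //; apply: CkD => //.
  apply: Ck_linl => //; first exact: lin_cont_mx.
  rewrite /U toverlapE.
  exact: (@Ck_linr _ _ _ _ k _ _ lsubmx oV cl (atlas_compatible i j k)).
apply: Ck_linl => //; first exact: lin_cont_mx.
rewrite /U toverlapE; apply: Ck_mulJ => //; exact: atlas_compatible.
Qed.

Lemma open_tmap i (O : set 'rV[R]_(n + n)) :
  open O -> open (tdom i `&` @tmap _ _ M i @^-1` O).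
Proof.
move=> oO; rewrite open_tangentE => j.
have -> : tmap j @` tdom j `&` tinv j @^-1` (tdom i `&` @tmap _ _ M i @^-1` O) =
  tmap j @` (tdom j `&` tdom i) `&` (fun y => tmap i (tinv j y)) @^-1` O.
  apply/seteqP; split => y.
    by move=> [[xi jp <-]]; rewrite /= tmapK // => -[ip Oi]; split => //; exists xi.
  by move=> [[xi [jp ip] <-]]; rewrite /= tmapK // => Oi; split => //; exists xi.
rewrite openE => y [Uy Oy]; apply: (@filterI _ (nbhs y)).
  by apply: open_nbhs_nbhs; split => //; exact: toverlap_open.
apply: (@ttransition_smooth j i 0%N y Uy).
by apply: open_nbhs_nbhs; split.
Qed.

Lemma tmap_continuous i xi : tdom i xi -> {for xi, continuous (@tmap _ _ M i)}.
Proof.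
move=> ip; apply: for_continuousP => O oO Oxi.
have : nbhs xi (tdom i `&` tmap i @^-1` O).
  by apply: open_nbhs_nbhs; split => //; exact: open_tmap.
by apply: filterS => z [].
Qed.

Lemma tinv_continuous i y : (tmap i @` @tdom _ _ M i) y ->
  {for y, continuous (@tinv _ _ M i)}.
Proof.
move=> iy; apply: for_continuousP => W oW Wy.
have : nbhs y (tmap i @` tdom i `&` tinv i @^-1` W).
  by apply: open_nbhs_nbhs; split => //; by move: oW; rewrite open_tangentE; apply.
by apply: filterS => z [].
Qed.

Definition tangent_chart i : chart R (n + n) (tangent_vector M) :=
  Chart (@tdom_open i) (@timg_open _ _ M i) (@tmapK _ _ M i) (@tmap_continuous i)
    (@tinv_continuous i).

Lemma tangent_cover xi : exists i, cdom (tangent_chart i) xi.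
Proof. by have [i ip] := atlas_cover (foot xi); exists i. Qed.

Lemma tangent_hausdorff : hausdorff_space (tangent_vector M).
Proof.
move=> xi zeta cl.
have ft : foot xi = foot zeta.
  apply: carrier_hausdorff => A B fA fB.
  have [w [Aw Bw]] := cl _ _ (foot_continuous fA) (foot_continuous fB).
  by exists (foot w).
have [i ip] := tangent_cover xi.
have iz : tdom i zeta by rewrite /tdom /= -ft.
rewrite -(tmapK ip) -(tmapK iz); congr tinv.
apply: (@norm_hausdorff R 'rV[R]_(n + n)) => A B fA fB.
have [w [Aw Bw]] := cl _ _ (tmap_continuous ip fA) (tmap_continuous iz fB).
by exists (tmap i w).
Qed.

Lemma tangent_second_countable : @second_countable (tangent_vector M).
Proof.
have [B cB [Bo Bb]] := carrier_second_countable M.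
have [Q cQ [Qo Qb]] := rV_second_countable R (n + n).
pose good (b : set M) (i : atlas_index M) := b `<=` cdom (atlas i).
pose sel (b : set M) : option (atlas_index M) :=
  if pselect (exists i, good b i) is left e then Some (projT1 (cid e)) else None.
pose W (bq : set M * set 'rV[R]_(n + n)) : set (tangent_vector M) :=
  if sel bq.1 is Some i then
    (@foot _ _ M) @^-1` bq.1 `&` (tdom i `&` tmap i @^-1` bq.2) else set0.
exists (W @` (B `*` Q)).
  by apply: sub_countable (card_image_le _ _) _; exact: countableX.
split.
  move=> _ [[b q] [/= Bb' Qq] <-]; rewrite /W /=.
  case: (sel b) => [i|]; last exact: open0.
  by apply: openI; [apply/open_foot/Bo | apply/open_tmap/Qo].
move=> xi A; rewrite nbhsE => -[A' [oA' A'xi] A'A].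
have [i ip] := tangent_cover xi.
have nip : nbhs (foot xi) (cdom (atlas i)).
  by apply: open_nbhs_nbhs; split => //; exact: cdom_open.
have [b [Bb' bxi] bi] := Bb (foot xi) _ nip.
have [i' si bi'] : exists2 i', sel b = Some i' & good b i'.
  rewrite /sel; case: pselect => [e|]; last by case; exists i.
  by exists (projT1 (cid e)) => //; case: cid.
have ip' : tdom i' xi by exact: bi'.
have iy : (tmap i' @` tdom i') (tmap i' xi) by exists xi.
have nA : nbhs (tmap i' xi) (tinv i' @^-1` A').
  by apply: (tinv_continuous iy); rewrite tmapK //; apply: open_nbhs_nbhs; split.
have [q [Qq qxi] qA] := Qb _ _ nA.
exists (W (b, q)); last first.
  by rewrite /W /= si => z [bz [iz qz]]; apply: A'A; rewrite -(tmapK iz); exact: qA.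
by split; [exists (b, q) | rewrite /W /= si].
Qed.

Definition tangent_bundle : manifold R (n + n) :=
  Manifold tangent_hausdorff tangent_second_countable tangent_cover
    ttransition_smooth.

End TangentBundleTheory.

Definition smooth_chart (R : realType) (n : nat) (M : manifold R n)
    (c : chart R n M) : Prop :=
  forall i, smooth (overlap (atlas i) c) (transition (atlas i) c) /\
            smooth (overlap c (atlas i)) (transition c (atlas i)).

Record smooth_map (R : realType) (m n : nat) (M : manifold R m)
    (N : manifold R n) := SmoothMap {
  smooth_fun :> M -> N;
  smooth_fun_continuous : continuous smooth_fun;
  smooth_fun_in_charts : forall i j,
    smooth (cmap (atlas i) @` (cdom (atlas i) `&` smooth_fun @^-1` cdom (atlas j)))
           (in_charts (atlas i) (atlas j) smooth_fun) }.

Definition local_diffeomorphism (R : realType) (n : nat) (M N : manifold R n)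
    (f : smooth_map M N) : Prop :=
  forall i j p, cdom (atlas i) p -> cdom (atlas j) (f p) ->
    'J (in_charts (atlas i) (atlas j) f) (cmap (atlas i) p) \in unitmx.

Section TangentMap.
Context {R : realType} {m n : nat} {M : manifold R m} {N : manifold R n}.
Variable f : smooth_map M N.

(* The charts i and j are arbitrary: see comp_tangent_map. *)
Definition tangent_map (xi : tangent_bundle M) : tangent_bundle N :=
  let i := projT1 (cid (atlas_cover (foot xi))) in
  let j := projT1 (cid (atlas_cover (f (foot xi)))) in
  tangent_of j (f (foot xi))
    (component xi i *m 'J (in_charts (atlas i) (atlas j) f) (cmap (atlas i) (foot xi))).

Lemma foot_tangent_map xi : foot (tangent_map xi) = f (foot xi).
Proof. by []. Qed.

Lemma smooth_map_diff i j p : cdom (atlas i) p -> cdom (atlas j) (f p) ->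
  differentiable (in_charts (atlas i) (atlas j) f) (cmap (atlas i) p).
Proof.
by move=> ip jp; apply: smooth_diff (smooth_fun_in_charts f i j) _; exists p.
Qed.

Lemma comp_tangent_map xi i j :
  cdom (atlas i) (foot xi) -> cdom (atlas j) (f (foot xi)) ->
  component (tangent_map xi) j =
  component xi i *m 'J (in_charts (atlas i) (atlas j) f) (cmap (atlas i) (foot xi)).
Proof.
move=> ip jp.
pose i0 := projT1 (cid (atlas_cover (foot xi))).
pose j0 := projT1 (cid (atlas_cover (f (foot xi)))).
have ip0 : cdom (atlas i0) (foot xi) by rewrite /i0; case: cid.
have jp0 : cdom (atlas j0) (f (foot xi)) by rewrite /j0; case: cid.
have fc : {for foot xi, continuous f} by exact: smooth_fun_continuous.
have E1 : component (tangent_map xi) j = component (tangent_map xi) j0 *m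
    'J (transition (atlas j0) (atlas j)) (cmap (atlas j0) (f (foot xi))).
  exact: (component_change (t := tangent_map xi)).
have E2 : component (tangent_map xi) j0 = component xi i0 *m
    'J (in_charts (atlas i0) (atlas j0) f) (cmap (atlas i0) (foot xi)).
  exact: (component_tangent_of _ jp0).
have E3 := @in_charts_comp _ _ _ _ _ _ _ _ _ (atlas j) _ id _ ip0 jp0 fc
  (smooth_map_diff ip0 jp0) (transition_diff jp0 jp).
have E4 := @in_charts_comp _ _ _ _ M M N (atlas i) (atlas i0) (atlas j) id f _ ip ip0
  (fun A h => h) (transition_diff ip ip0) (smooth_map_diff ip0 jp).
have E5 := component_change (t := xi) ip ip0.
refine (etrans E1 _); refine (etrans (f_equal (mulmx^~ _) E2) _).
refine (etrans (esym (mulmxA _ _ _)) _).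
refine (etrans (f_equal (mulmx _) (esym E3)) _).
refine (etrans (f_equal (mulmx^~ _) E5) _).
refine (etrans (esym (mulmxA _ _ _)) _).
exact: (f_equal (mulmx _) (esym E4)).
Qed.

End TangentMap.

(* A smooth (1,1)-tensor field, given by its matrix at each point of each chart.
   The values of tensor_comp i outside cdom (atlas i) are irrelevant. *)
Record tensor11 (R : realType) (n : nat) (M : manifold R n) := Tensor11 {
  tensor_comp :> atlas_index M -> M -> 'M[R]_n;
  tensor_smooth : forall i,
    smooth (cmap (atlas i) @` cdom (atlas i))
           (fun x => tensor_comp i (cinv (atlas i) x));
  tensor_change : forall i j p, cdom (atlas i) p -> cdom (atlas j) p ->
    tensor_comp i p *m 'J (transition (atlas i) (atlas j)) (cmap (atlas i) p) =
    'J (transition (atlas i) (atlas j)) (cmap (atlas i) p) *m tensor_comp j p }.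

Variant structure_kind := Complex | ParaComplex.

Definition structure_matrix (k : structure_kind) (R : realType) (n : nat)
    (A : 'M[R]_n) : Prop :=
  match k with
  | Complex => A *m A = - 1%:M
  | ParaComplex =>
      A *m A = 1%:M /\ \rank (eigenspace A 1) = \rank (eigenspace A (-1))
  end.

Record almost_structure (k : structure_kind) (R : realType) (n : nat)
    (M : manifold R n) := AlmostStructure {
  structure_tensor :> tensor11 M;
  structure_tensorP : forall i p, cdom (atlas i) p ->
    structure_matrix k (structure_tensor i p) }.

(* Around each point there is a chart c, compatible with the atlas, in which the
   matrix of J is a constant A. *)
Definition integrable (R : realType) (n : nat) (M : manifold R n)
    (J : tensor11 M) : Prop :=
  forall p : M, exists c : chart R n M,
    [/\ smooth_chart c, cdom c p &
      exists A : 'M[R]_n, forall i q, cdom (atlas i) q -> cdom c q ->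
        J i q *m 'J (transition (atlas i) c) (cmap (atlas i) q) =
        'J (transition (atlas i) c) (cmap (atlas i) q) *m A].

(* The differential of f intertwines J and K. *)
Definition intertwines (R : realType) (m n : nat) (M : manifold R m)
    (N : manifold R n) (J : tensor11 M) (K : tensor11 N) (f : M -> N) : Prop :=
  forall i j p, cdom (atlas i) p -> cdom (atlas j) (f p) ->
    J i p *m 'J (in_charts (atlas i) (atlas j) f) (cmap (atlas i) p) =
    'J (in_charts (atlas i) (atlas j) f) (cmap (atlas i) p) *m K j (f p).

(* Canonicity as naturality under local diffeomorphisms. Taking for f a coordinate
   chart, a change of coordinates, the inclusion of an open subset, or the
   identity between two atlases of the same smooth structure, it says that the
   lifted structure is determined, locally and independently of the choice of
   local coordinates, by the given one. *)
Definition canonical_lift (k : structure_kind) (R : realType) (n : nat)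
    (lift : forall M : manifold R n,
      almost_structure k M -> almost_structure k (tangent_bundle M)) : Prop :=
  forall (M N : manifold R n) (J : almost_structure k M) (K : almost_structure k N)
    (f : smooth_map M N),
    local_diffeomorphism f -> intertwines J K f ->
    intertwines (lift M J) (lift N K) (tangent_map f).

(* Main.v *)
Require Import Defs.
From mathcomp Require Import all_boot all_order all_algebra.
From mathcomp Require Import boolp classical_sets functions reals topology normedtype derive.
From mathcomp Require Import realfun ring.
Set Implicit Arguments.
Unset Strict Implicit.
Unset Printing Implicit Defensive.
Import Order.TTheory GRing.Theory Num.Theory.
Import numFieldNormedType.Exports.
Local Open Scope classical_set_scope.
Local Open Scope ring_scope.

(** The structure on the tangent bundle is the complete lift of J. Think of a
    tangent vector with coordinates y = (x, v) as the point x + e v, where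
    e ^+ 2 = 0. A matrix-valued function A on an open set of R^m then takes at
    x + e v the value A x + e D_v A x, which [prolong A y] encodes as the block
    matrix with A x on the diagonal and D_v A x above it; likewise the value
    f x + e D_v f x of a map f is the point [tangent_fun f y], which is the
    tangent map of f in coordinates. If A is the matrix of J in a chart of M,
    the complete lift has the matrix [prolong A] in the associated chart of the
    tangent bundle.

    Everything rests on the compatibility of prolongation with the operations of
    calculus. By the Leibniz rule it respects products ([prolong_mulmx]), by the
    chain rule it respects composition ([prolong_comp], [tangent_fun_comp]), and
    the Jacobian matrix of a tangent map is the prolongation of the Jacobian
    matrix ([jacobian_tangent_fun]). The last fact is where the symmetry of
    second derivatives enters ([derive_sym]): the block of 'J (tangent_fun f)
    coupling x to the second component is u |-> D_u (D_v f), and has to be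
    compared with u |-> D_v (D_u f). Consequently a relation
    A *m 'J f = 'J f *m (B \o f), which says that f carries the tensor A to the
    tensor B, is inherited by the prolongations ([prolong_intertwine]).

    Used with transition maps, this shows that the complete lift is a tensor on
    the tangent bundle; used with the expressions of a smooth map, that it is
    natural. The identity A *m A = -1 or 1 prolongs to the same identity. In the
    para-complex case the eigenspaces keep equal dimensions, because the
    prolonged matrix is similar to the block diagonal matrix with two copies of
    A ([rank_eigenspace_block]). Finally a chart of M in which J is constant
    induces a chart of the tangent bundle in which the matrix of the lift is the
    prolongation of a constant, hence again constant. *)

(** * Symmetry of second derivatives *)

Section Schwarz.
Context {R : realType} {V : normedModType R}.
Implicit Types (f : V -> R) (x u v : V) (U : set V) (h : R).

Lemma is_derive_line f x v t : differentiable f (x + t *: v) ->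
  is_derive t 1 (fun s : R => f (x + s *: v)) ('D_v f (x + t *: v)).
Proof.
move=> df.
have dl : is_diff t (fun s : R => x + s *: v) (fun s : R => s *: v).
  have -> : (fun s : R => s *: v) = 0 + (fun s : R => s *: v) by rewrite add0r.
  exact: (is_diffD (is_diff_cst x t) (is_diff_scalel t v)).
have dl' : differentiable (fun s : R => x + s *: v) t by apply: ex_diff.
have dc : differentiable (f \o (fun s : R => x + s *: v)) t by exact: differentiable_comp.
apply: DeriveDef; first exact: diff_derivable.
rewrite (deriveE (1 : R) dc) (diff_comp dl' df) /= (diff_val (is_diff_def := dl)).
by rewrite scale1r deriveE.
Qed.

Lemma mvt_line f x v h : 0 < h ->
  (forall t, 0 <= t <= h -> differentiable f (x + t *: v)) ->
  exists2 t, 0 <= t <= h & f (x + h *: v) - f x = h * 'D_v f (x + t *: v).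
Proof.
move=> h0 df.
have [||t] := @MVT R (fun s => f (x + s *: v)) (fun s => 'D_v f (x + s *: v)) 0 h h0.
- move=> t; rewrite in_itv /= => /andP[/ltW t0 /ltW th].
  by apply: is_derive_line; apply: df; rewrite t0.
- apply: derivable_within_continuous => t; rewrite in_itv /= => th.
  exact: (@ex_derive _ _ _ _ _ _ _ (is_derive_line (df t th))).
rewrite in_itv /= => /andP[/ltW t0 /ltW th] E; exists t; first by rewrite t0.
by move: E; rewrite scale0r addr0 subr0 mulrC.
Qed.

Lemma differentiable_shift (W : normedModType R) (g : V -> W) x w :
  differentiable g (x + w) -> differentiable (fun z => g (z + w)) x.
Proof.
by move=> dg; apply: (@differentiable_comp _ _ _ _ (fun z => z + w) g).
Qed.

Lemma derive_shift (W : normedModType R) (g : V -> W) x u w :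
  'D_u (fun z => g (z + w)) x = 'D_u g (x + w).
Proof. by rewrite /derive; under eq_fun do rewrite /= -addrA. Qed.

(** The mean value theorem, applied along u to the increment of f in the
    direction v, and then along v to 'D_u f, turns a second difference into a
    value of the mixed derivative. *)
Lemma mvt_square f x u v h : 0 < h ->
  (forall s t : R, 0 <= s <= h -> 0 <= t <= h ->
    differentiable f (x + s *: u + t *: v) /\
    differentiable ('D_u f) (x + s *: u + t *: v)) ->
  exists s t : R, [/\ 0 <= s <= h, 0 <= t <= h &
    f (x + h *: u + h *: v) - f (x + h *: u) - (f (x + h *: v) - f x) =
    h * (h * 'D_v ('D_u f) (x + s *: u + t *: v))].
Proof.
move=> h0 df; have hh : 0 <= h <= h by rewrite ltW /=.
have zh : 0 <= (0 : R) <= h by apply/andP; split=> //; exact: ltW.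
have d1 s : 0 <= s <= h -> differentiable f (x + s *: u + h *: v) by move=> sh; case: (df s h).
have d0 s : 0 <= s <= h -> differentiable f (x + s *: u).
  by move=> sh; case: (df s 0 sh zh); rewrite scale0r addr0.
have [s sh Es] := @mvt_line (fun z => f (z + h *: v) - f z) x u h h0
  (fun s sh => differentiableB (differentiable_shift (d1 s sh)) (d0 s sh)).
have [t th Et] := @mvt_line ('D_u f) (x + s *: u) v h h0 (fun t th => (df s t sh th).2).
exists s, t; split => //; rewrite -Et -derive_shift {}Es; congr (_ * _).
apply: deriveB; apply: diff_derivable; last exact: d0.
exact: differentiable_shift (d1 s sh).
Qed.

(** The numbers a, ..., d are the values of f at the vertices of a parallelogram,
    and the two second differences differ by the order of b and c. The vertex with
    value a is reached by adding the sides in either order, whence a'. *)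
Lemma mixed_quotient_eq (h a a' b c d A B : R) : 0 < h ->
  a - b - (c - d) = h * (h * A) -> a' - c - (b - d) = h * (h * B) -> a = a' ->
  A = B.
Proof.
move=> h0 EA EB aa'; have hn0 : h != 0 by rewrite gt_eqF.
apply: (mulfI hn0); apply: (mulfI hn0); rewrite -EA -EB aa'.
by ring.
Qed.

Lemma ler_dist_common (e a b c : R) : `|a - c| < e / 2 -> `|b - c| < e / 2 -> `|a - b| <= e.
Proof.
move=> ac bc; rewrite (le_trans (ler_distD c _ _)) // [leRHS]splitr.
by rewrite lerD // ltW // distrC.
Qed.

(** The second difference over the parallelogram spanned by h *: u and h *: v is
    symmetric in u and v. By [mvt_square] it is h ^+ 2 times a value of either
    mixed derivative near x, so the continuity of both at x identifies them. *)
Lemma derive_sym f U x u v : open U -> Ck 2 U f -> U x ->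
  'D_v ('D_u f) x = 'D_u ('D_v f) x.
Proof.
move=> oU [df Df] Ux.
have nU : nbhs x U by exact: open_nbhs_nbhs.
have /cvgrPdist_lt cuv := (Df u).2 v x Ux.
have /cvgrPdist_lt cvu := (Df v).2 u x Ux.
apply/eqP; rewrite -subr_eq0 -normr_le0; apply/ler_addgt0Pl => e e0; rewrite addr0.
have e2 : 0 < e / 2 by rewrite divr_gt0.
have : nbhs x (U `&` ([set z | `|'D_v ('D_u f) x - 'D_v ('D_u f) z| < e / 2] `&`
    [set z | `|'D_u ('D_v f) x - 'D_u ('D_v f) z| < e / 2])).
  exact: @filterI _ (nbhs x) _ _ _ nU (@filterI _ (nbhs x) _ _ _ (cuv _ e2) (cvu _ e2)).
move=> /nbhs_ballP[r /= r0 Hr].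
(* A parallelogram with sides h *: u and h *: v is contained in the ball of
   radius r; the summand 1 keeps d nonzero when u = v = 0. *)
pose d := `|u| + `|v| + 1; have d0 : 0 < d by rewrite ltr_wpDl // addr_ge0.
pose h := r / d; have h0 : 0 < h by rewrite divr_gt0.
have near (s t : R) : 0 <= s <= h -> 0 <= t <= h -> ball x r (x + s *: u + t *: v).
  move=> /andP[s0 sh] /andP[t0 th]; rewrite -ball_normE /= -addrA opprD addNKr normrN.
  have : `|s *: u + t *: v| <= h * (`|u| + `|v|).
    rewrite (le_trans (ler_normD _ _)) // !normrZ !ger0_norm // mulrDr.
    by rewrite lerD // ler_wpM2r.
  move=> /le_lt_trans; apply; rewrite /h -mulrA gtr_pMr // mulrC ltr_pdivrMr //.
  by rewrite mul1r ltrDl.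
have diffs w (s t : R) : 0 <= s <= h -> 0 <= t <= h ->
    differentiable f (x + s *: u + t *: v) /\
    differentiable ('D_w f) (x + s *: u + t *: v).
  by move=> sh th; have [Uz _] := Hr _ (near s t sh th); split;
    [exact: df|exact: (Df w).1].
have [s [t [sh th E]]] := mvt_square h0 (diffs u).
have [t' [s' [th' sh' E']]] : exists t' s' : R, [/\ 0 <= t' <= h, 0 <= s' <= h &
    f (x + h *: v + h *: u) - f (x + h *: v) - (f (x + h *: u) - f x) =
    h * (h * 'D_u ('D_v f) (x + t' *: v + s' *: u))].
  by apply: mvt_square => // a b ah bh; rewrite addrAC; exact: diffs.
have {E E'} E : 'D_v ('D_u f) (x + s *: u + t *: v) =
    'D_u ('D_v f) (x + s' *: u + t' *: v).
  rewrite (addrAC x (s' *: u)); apply: (mixed_quotient_eq h0 E E').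
  by rewrite (addrAC x (h *: v)).
have [_ [a1 _]] := Hr _ (near s t sh th).
have [_ [_ a2]] := Hr _ (near s' t' sh' th').
by apply: (ler_dist_common a1); rewrite E.
Qed.

End Schwarz.

(** * Differential calculus of matrix-valued functions *)

Section Calculus.
Context {R : realType}.

Lemma Ck_sub (V W : normedModType R) k (U U' : set V) (f : V -> W) :
  U `<=` U' -> Ck k U' f -> Ck k U f.
Proof.
move=> UU'; elim: k f => [|k IH] f /=; first by move=> cf x /UU'; exact: cf.
by move=> [df Df]; split=> [x /UU'|v]; [exact: df|exact: IH].
Qed.

Lemma smooth_sub (V W : normedModType R) (U U' : set V) (f : V -> W) :
  U `<=` U' -> smooth U' f -> smooth U f.
Proof. by move=> UU' sf k; exact: Ck_sub (sf k). Qed.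

Lemma Ck_matrixP (V : normedModType R) k (U : set V) m n (f : V -> 'M[R]_(m, n)) :
  open U -> (forall i j, Ck k U (fun x => f x i j)) -> Ck k U f.
Proof.
move=> oU cf.
have -> : f = fun x => \sum_i \sum_j f x i j *: delta_mx i j.
  by apply/funext => x; exact: matrix_sum_delta.
by apply: Ck_sum => // i; apply: Ck_sum => // j; apply: CkZl.
Qed.

Lemma Ck_row_mx (V : normedModType R) k (U : set V) m n p
    (A : V -> 'M[R]_(m, n)) (B : V -> 'M[R]_(m, p)) :
  open U -> Ck k U A -> Ck k U B -> Ck k U (fun x => row_mx (A x) (B x)).
Proof.
move=> oU cA cB; apply: Ck_matrixP => // i j.
case: (split_ordP j) => l ->.
- apply: (@Ck_eq _ _ _ _ _ (fun x => A x i l)) => //; last exact: Ck_coord.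
  by move=> x _; rewrite row_mxEl.
- apply: (@Ck_eq _ _ _ _ _ (fun x => B x i l)) => //; last exact: Ck_coord.
  by move=> x _; rewrite row_mxEr.
Qed.

Lemma Ck_col_mx (V : normedModType R) k (U : set V) m n p
    (A : V -> 'M[R]_(m, n)) (B : V -> 'M[R]_(p, n)) :
  open U -> Ck k U A -> Ck k U B -> Ck k U (fun x => col_mx (A x) (B x)).
Proof.
move=> oU cA cB; apply: Ck_matrixP => // i j.
case: (split_ordP i) => l ->.
- apply: (@Ck_eq _ _ _ _ _ (fun x => A x l j)) => //; last exact: Ck_coord.
  by move=> x _; rewrite col_mxEu.
- apply: (@Ck_eq _ _ _ _ _ (fun x => B x l j)) => //; last exact: Ck_coord.
  by move=> x _; rewrite col_mxEd.
Qed.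

Lemma Ck_jacobian k m n (U : set 'rV[R]_m) (f : 'rV[R]_m -> 'rV[R]_n) :
  open U -> Ck k.+1 U f -> Ck k U (fun x => 'J f x).
Proof.
move=> oU [df Df]; apply: Ck_matrixP => // i j.
apply: (@Ck_eq _ _ _ _ _ (fun x => ('D_(delta_mx ord0 i) f x) ord0 j)) => //.
  by move=> x Ux; rewrite jacobian_coord //; exact: df.
exact: (@Ck_coord _ _ _ _ 1 n ('D_(delta_mx ord0 i) f) ord0 j oU (Df _)).
Qed.

(** In coordinates a derivative in a variable direction becomes a combination,
    with variable coefficients, of derivatives in fixed directions, and only the
    latter are covered by the recursion that defines [Ck]. *)
Lemma derive_row_sum (W : normedModType R) m (f : 'rV[R]_m -> W) x v :
  differentiable f x ->
  'D_v f x = \sum_i v ord0 i *: 'D_(delta_mx ord0 i) f x.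
Proof.
move=> df; rewrite deriveE // {1}[v]row_sum_delta linear_sum.
by apply: eq_bigr => i _; rewrite linearZ /= deriveE.
Qed.

Lemma derive_comp (V W Z : normedModType R) (f : V -> W) (g : W -> Z) x v :
  differentiable f x -> differentiable g (f x) ->
  'D_v (fun z => g (f z)) x = 'D_('D_v f x) g (f x).
Proof.
move=> df dg; rewrite (deriveE v (differentiable_comp df dg)) diff_comp //=.
by rewrite !deriveE.
Qed.

(** By the chain rule, 'D_v (g \o f) is the sum of the products of the
    coordinates of 'D_v f with the functions 'D_(delta_mx ord0 i) g \o f, which
    are covered by the induction hypothesis. *)
Lemma Ck_comp (V : normedModType R) k m p q (U : set V) (U' : set 'rV[R]_m)
    (f : V -> 'rV[R]_m) (g : 'rV[R]_m -> 'M[R]_(p, q)) :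
  open U -> (forall x, U x -> U' (f x)) -> Ck k U f -> Ck k U' g ->
  Ck k U (fun x => g (f x)).
Proof.
move=> oU fU; elim: k g => [|k IH] g.
  by move=> cf cg x Ux; apply: continuous_comp; [exact: cf|apply: cg; exact: fU].
move=> cf [dg Dg]; have [df Df] := cf; split.
  by move=> x Ux; apply: differentiable_comp; [exact: df|apply: dg; exact: fU].
move=> v; pose s i x := ('D_v f x) ord0 i.
apply: (@Ck_eq _ _ _ _ _
    (fun x => \sum_i s i x *: 'D_(delta_mx ord0 i) g (f x))) => //.
  move=> x Ux; rewrite derive_comp; [|exact: df|by apply: dg; exact: fU].
  by rewrite [RHS]derive_row_sum //; apply: dg; exact: fU.
apply: Ck_sum => // i; apply: Ck_matrixP => // a b.
apply: (@Ck_eq _ _ _ _ _ (fun x => s i x * 'D_(delta_mx ord0 i) g (f x) a b)) => //.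
  by move=> x _; rewrite mxE.
apply: CkM => //; first exact: (@Ck_coord _ _ _ _ 1 m ('D_v f) ord0 i oU (Df v)).
apply: (@Ck_coord _ _ _ _ p q (fun x => 'D_(delta_mx ord0 i) g (f x)) a b oU).
by apply: IH (Dg _); exact: CkS.
Qed.

Lemma smooth_comp (V : normedModType R) m p q (U : set V) (U' : set 'rV[R]_m)
    (f : V -> 'rV[R]_m) (g : 'rV[R]_m -> 'M[R]_(p, q)) :
  open U -> (forall x, U x -> U' (f x)) -> smooth U f -> smooth U' g ->
  smooth U (fun x => g (f x)).
Proof. by move=> oU fU sf sg k; exact: Ck_comp fU (sf k) (sg k). Qed.

Lemma Ck_derive_dir k m p q (U : set 'rV[R]_m) (A : 'rV[R]_m -> 'M[R]_(p, q)) :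
  open U -> Ck k.+1 U A ->
  Ck k ([set y | U (lsubmx y)] : set 'rV[R]_(m + m))
    (fun y => 'D_(rsubmx y) A (lsubmx y)).
Proof.
move=> oU [dA DA].
have oTU : open ([set y | U (lsubmx y)] : set 'rV[R]_(m + m)).
  by apply: open_comp => // y _; exact: continuous_lsubmx.
apply: (@Ck_eq _ _ _ _ _ (fun y => \sum_i
   (rsubmx y) ord0 i *: 'D_(delta_mx ord0 i) A (lsubmx y))) => //.
  by move=> y Uy; rewrite [RHS]derive_row_sum //; exact: dA.
apply: Ck_sum => // i; apply: Ck_matrixP => // a b.
apply: (@Ck_eq _ _ _ _ _ (fun y =>
   (rsubmx y) ord0 i * 'D_(delta_mx ord0 i) A (lsubmx y) a b)) => //.
  by move=> y _; rewrite [RHS]mxE.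
apply: CkM => //.
  apply: (@Ck_coord _ _ _ _ 1 m (fun y => rsubmx y) ord0 i oTU).
  by apply: Ck_lin => //; exact: continuous_rsubmx.
apply: (@Ck_coord _ _ _ _ p q (fun y => 'D_(delta_mx ord0 i) A (lsubmx y)) a b oTU).
exact: (@Ck_linr _ _ _ _ k U ('D_(delta_mx ord0 i) A) lsubmx oU
  (@continuous_lsubmx _ _ _ _) (DA _)).
Qed.

Lemma derive_mulmx (V : normedModType R) m n p (A : V -> 'M[R]_(m, n))
    (B : V -> 'M[R]_(n, p)) x v :
  derivable A x v -> derivable B x v ->
  'D_v (fun z => A z *m B z) x = 'D_v A x *m B x + A x *m 'D_v B x.
Proof.
move=> dA dB; have dAc := (derivable_mxP _ _ _).1 dA.
have dBc := (derivable_mxP _ _ _).1 dB.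
have E i j : (fun z => (A z *m B z) i j) =
    \sum_l ((fun z => A z i l) * (fun z => B z l j)).
  by apply/funext => z; rewrite [LHS]mxE fct_sumE.
have dAB i j l : derivable ((fun z => A z i l) * (fun z => B z l j)) x v.
  exact: derivableM.
rewrite derive_mx; last first.
  by apply/derivable_mxP => i j; rewrite E; exact: derivable_sum.
apply/matrixP => i j; rewrite mxE E derive_sum //.
rewrite (derive_mx dA) (derive_mx dB) !mxE -big_split; apply: eq_bigr => l _ /=.
rewrite deriveM // [X in _ = X * _ + _]mxE [X in _ = _ + _ * X]mxE addrC.
by congr (_ + _); exact: mulrC.
Qed.

End Calculus.

(** * Prolongation to the tangent space *)

Section Prolongation.
Context {R : realType}.

Lemma derive_sym_mx m p q (f : 'rV[R]_m -> 'M[R]_(p, q)) (U : set 'rV[R]_m) x u v :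
  open U -> Ck 2 U f -> U x -> 'D_v ('D_u f) x = 'D_u ('D_v f) x.
Proof.
move=> oU cf Ux; have [df Df] := cf.
have E a b i j : ('D_b ('D_a f) x) i j = 'D_b ('D_a (fun z => f z i j)) x.
  rewrite derive_mx ?mxE; last by apply: diff_derivable; exact: (Df a).1.
  apply: near_eq_derive; apply: open_near_eq oU _ Ux => z Uz.
  by rewrite derive_mx ?mxE //; apply: diff_derivable; exact: df.
apply/matrixP => i j; apply: (etrans (E u v i j) (etrans _ (esym (E v u i j)))).
exact: derive_sym oU (Ck_coord i j oU cf) Ux.
Qed.

Lemma derive_row_mx (V : normedModType R) m n p (A : V -> 'M[R]_(m, n))
    (B : V -> 'M[R]_(m, p)) x v : derivable A x v -> derivable B x v ->
  'D_v (fun z => row_mx (A z) (B z)) x = row_mx ('D_v A x) ('D_v B x).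
Proof.
move=> dA dB; have dAc := (derivable_mxP _ _ _).1 dA.
have dBc := (derivable_mxP _ _ _).1 dB.
have El i j : (fun z => row_mx (A z) (B z) i (lshift p j)) = fun z => A z i j.
  by apply/funext => z; rewrite row_mxEl.
have Er i j : (fun z => row_mx (A z) (B z) i (rshift n j)) = fun z => B z i j.
  by apply/funext => z; rewrite row_mxEr.
rewrite derive_mx; last first.
  by apply/derivable_mxP => i j; case: (split_ordP j) => l ->; rewrite ?El ?Er.
rewrite (derive_mx dA) (derive_mx dB); apply/matrixP => i j; rewrite [LHS]mxE.
by case: (split_ordP j) => l ->; rewrite ?El ?Er ?row_mxEl ?row_mxEr mxE.
Qed.

Lemma derive_lsubmx m n (y w : 'rV[R]_(m + n)) :
  'D_w (lsubmx : 'rV[R]_(m + n) -> 'rV[R]_m) y = lsubmx w.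
Proof.
rewrite deriveE; last exact: differentiable_lsubmx.
by rewrite diff_lin //; exact: continuous_lsubmx.
Qed.

Lemma derive_rsubmx m n (y w : 'rV[R]_(m + n)) :
  'D_w (rsubmx : 'rV[R]_(m + n) -> 'rV[R]_n) y = rsubmx w.
Proof.
rewrite deriveE; last exact: differentiable_rsubmx.
by rewrite diff_lin //; exact: continuous_rsubmx.
Qed.

(** A vector of R^(m + m) has the base point as left half and the tangent vector
    as right half. The matrix represents the value A x + e D_v A x over the dual
    numbers: products of such values are products of block matrices. *)
Definition prolong m p q (A : 'rV[R]_m -> 'M[R]_(p, q)) (y : 'rV[R]_(m + m)) :
    'M[R]_(p + p, q + q) :=
  block_mx (A (lsubmx y)) ('D_(rsubmx y) A (lsubmx y)) 0 (A (lsubmx y)).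

Definition tangent_fun m n (f : 'rV[R]_m -> 'rV[R]_n) (y : 'rV[R]_(m + m)) :
    'rV[R]_(n + n) :=
  row_mx (f (lsubmx y)) ('D_(rsubmx y) f (lsubmx y)).

Lemma open_lsubmx m (U : set 'rV[R]_m) :
  open U -> open ([set y | U (lsubmx y)] : set 'rV[R]_(m + m)).
Proof.
by move=> oU; apply: open_comp => // y _; exact: continuous_lsubmx.
Qed.

Lemma Ck_comp_lsubmx k m p q (U : set 'rV[R]_m) (A : 'rV[R]_m -> 'M[R]_(p, q)) :
  open U -> Ck k U A ->
  Ck k ([set y | U (lsubmx y)] : set 'rV[R]_(m + m)) (fun y => A (lsubmx y)).
Proof.
move=> oU cA; exact: (@Ck_linr _ _ _ _ k U A lsubmx oU (@continuous_lsubmx _ _ _ _) cA).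
Qed.

Lemma Ck_prolong k m p q (U : set 'rV[R]_m) (A : 'rV[R]_m -> 'M[R]_(p, q)) :
  open U -> Ck k.+1 U A -> Ck k [set y | U (lsubmx y)] (prolong A).
Proof.
move=> oU cA; have oTU := open_lsubmx oU.
have cA0 := Ck_comp_lsubmx oU (CkS cA).
apply: Ck_col_mx => //; apply: Ck_row_mx => //; first exact: Ck_derive_dir.
exact: Ck_cst.
Qed.

Lemma Ck_tangent_fun k m n (U : set 'rV[R]_m) (f : 'rV[R]_m -> 'rV[R]_n) :
  open U -> Ck k.+1 U f -> Ck k [set y | U (lsubmx y)] (tangent_fun f).
Proof.
move=> oU cf; have oTU := open_lsubmx oU.
by apply: Ck_row_mx => //; [exact: Ck_comp_lsubmx oU (CkS cf)|exact: Ck_derive_dir].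
Qed.

Lemma near_eq_prolong m p q (A B : 'rV[R]_m -> 'M[R]_(p, q)) (y : 'rV[R]_(m + m)) :
  {near lsubmx y, A =1 B} -> prolong A y = prolong B y.
Proof.
move=> AB; rewrite /prolong (near_eq_derive _ AB).
by rewrite (nbhs_singleton AB).
Qed.

Lemma prolong_cst m p q (A : 'M[R]_(p, q)) (y : 'rV[R]_(m + m)) :
  prolong (fun _ : 'rV[R]_m => A) y = block_mx A 0 0 A.
Proof. by rewrite /prolong derive_cst. Qed.

Lemma prolong_mulmx m p q r (A : 'rV[R]_m -> 'M[R]_(p, q))
    (B : 'rV[R]_m -> 'M[R]_(q, r)) (y : 'rV[R]_(m + m)) :
  differentiable A (lsubmx y) -> differentiable B (lsubmx y) ->
  prolong (fun x => A x *m B x) y = prolong A y *m prolong B y.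
Proof.
move=> dA dB; rewrite /prolong mulmx_block derive_mulmx; try exact: diff_derivable.
by rewrite !mul0mx !mulmx0 !addr0 add0r addrC.
Qed.

Lemma prolong_comp m n p q (A : 'rV[R]_n -> 'M[R]_(p, q)) (f : 'rV[R]_m -> 'rV[R]_n)
    (y : 'rV[R]_(m + m)) :
  differentiable f (lsubmx y) -> differentiable A (f (lsubmx y)) ->
  prolong (fun x => A (f x)) y = prolong A (tangent_fun f y).
Proof.
by move=> df dA; rewrite /prolong /tangent_fun row_mxKl row_mxKr (derive_comp _ df dA).
Qed.

Lemma tangent_fun_comp m n p (g : 'rV[R]_n -> 'rV[R]_p) (f : 'rV[R]_m -> 'rV[R]_n)
    (y : 'rV[R]_(m + m)) :
  differentiable f (lsubmx y) -> differentiable g (f (lsubmx y)) ->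
  tangent_fun (fun x => g (f x)) y = tangent_fun g (tangent_fun f y).
Proof.
by move=> df dg; rewrite /tangent_fun row_mxKl row_mxKr (derive_comp _ df dg).
Qed.

(** With y = (x, v), the derivative of z |-> 'D_(rsubmx z) f (lsubmx z) at y in
    the direction w is rsubmx w *m 'J f x + 'D_(lsubmx w) ('D_v f) x. Exchanging
    the two derivatives turns the last term into lsubmx w *m 'D_v ('J f) x, that
    is, into a contribution of the upper right block of the prolongation. *)
Lemma jacobian_tangent_fun m n (U : set 'rV[R]_m) (f : 'rV[R]_m -> 'rV[R]_n)
    (y : 'rV[R]_(m + m)) :
  open U -> Ck 2 U f -> U (lsubmx y) ->
  'J (tangent_fun f) y = prolong (fun x => 'J f x) y.
Proof.
move=> oU cf Uy; set x := lsubmx y; set v := rsubmx y; have [df _] := cf.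
have [dJ _] := Ck_jacobian oU cf.
have oTU := open_lsubmx oU.
have [dT _] := Ck_tangent_fun oU cf.
have mulJ a b : a *m 'D_b (fun z => 'J f z) x = 'D_b ('D_a f) x.
  have <- : 'D_b (fun z => a *m 'J f z) x = 'D_b ('D_a f) x.
    apply: near_eq_derive; apply: open_near_eq oU _ Uy => z Uz.
    by rewrite deriveEjacobian //; exact: df.
  rewrite derive_mulmx; [|exact: derivable_cst|by apply: diff_derivable; exact: dJ].
  by rewrite derive_cst mul0mx add0r.
apply/row_matrixP => i; rewrite !rowE; move: (delta_mx _ _) => w.
rewrite -deriveEjacobian; last exact: dT.
have dl := @differentiable_lsubmx R 1 m m y.
have dr := @differentiable_rsubmx R 1 m m y.
have dfl : differentiable (fun z : 'rV[R]_(m + m) => f (lsubmx z)) y.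
  by apply: differentiable_comp => //; exact: df.
have dJl : differentiable (fun z : 'rV[R]_(m + m) => 'J f (lsubmx z)) y.
  exact: (@differentiable_comp _ _ _ _ lsubmx (fun z => 'J f z) y dl (dJ _ Uy)).
have [dD _] := Ck_derive_dir oU cf.
rewrite derive_row_mx; [|exact: diff_derivable|by apply: diff_derivable; exact: dD].
have -> : 'D_w (fun z : 'rV[R]_(m + m) => f (lsubmx z)) y = lsubmx w *m 'J f x.
  by rewrite (derive_comp w dl (df _ Uy)) derive_lsubmx deriveEjacobian //; exact: df.
have -> : 'D_w (fun z : 'rV[R]_(m + m) => 'D_(rsubmx z) f (lsubmx z)) y =
    rsubmx w *m 'J f x + v *m 'D_(lsubmx w) (fun z => 'J f z) x.
  transitivity ('D_w (fun z : 'rV[R]_(m + m) => rsubmx z *m 'J f (lsubmx z)) y).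
    apply: near_eq_derive; apply: open_near_eq oTU _ Uy => z Uz.
    by rewrite deriveEjacobian //; exact: df.
  rewrite derive_mulmx; [|exact: diff_derivable|exact: diff_derivable].
  by rewrite derive_rsubmx (derive_comp w dl (dJ _ Uy)) derive_lsubmx.
rewrite mulJ (derive_sym_mx _ _ oU cf Uy) -mulJ.
rewrite -[w in RHS]hsubmxK mul_row_block mulmx0 addr0.
by rewrite [X in row_mx _ X]addrC.
Qed.

Lemma near_eq_tangent_fun m n (f g : 'rV[R]_m -> 'rV[R]_n) (y : 'rV[R]_(m + m)) :
  {near lsubmx y, f =1 g} -> tangent_fun f y = tangent_fun g y.
Proof.
move=> fg; rewrite /tangent_fun (near_eq_derive _ fg).
by rewrite (nbhs_singleton fg).
Qed.

Lemma tangent_fun_id m (y : 'rV[R]_(m + m)) : tangent_fun id y = y.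
Proof. by rewrite /tangent_fun derive_id hsubmxK. Qed.

(** Both sides of A *m 'J f = 'J f *m (B \o f) are products of matrix-valued
    functions, which can be prolonged factor by factor, and the prolongation of
    'J f is the Jacobian matrix of the tangent map. The map F stands for the
    coordinate expression of a map of tangent bundles, which need not agree with
    [tangent_fun f] outside U. *)
Lemma prolong_intertwine m n (U : set 'rV[R]_m) (f : 'rV[R]_m -> 'rV[R]_n)
    (F : 'rV[R]_(m + m) -> 'rV[R]_(n + n)) (A : 'rV[R]_m -> 'M[R]_m)
    (B : 'rV[R]_n -> 'M[R]_n) (y : 'rV[R]_(m + m)) :
  open U -> Ck 2 U f -> (forall z, U (lsubmx z) -> F z = tangent_fun f z) ->
  (forall x, U x -> A x *m 'J f x = 'J f x *m B (f x)) ->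
  U (lsubmx y) -> differentiable A (lsubmx y) -> differentiable B (f (lsubmx y)) ->
  prolong A y *m 'J F y = 'J F y *m prolong B (F y).
Proof.
move=> oU cf Ff AB Uy dA dB; have [df _] := cf.
have [dJ _] := Ck_jacobian oU cf.
have oTU := open_lsubmx oU.
have [dT _] := Ck_tangent_fun oU cf.
have -> : 'J F y = prolong (fun x => 'J f x) y.
  rewrite -(jacobian_tangent_fun oU cf Uy); apply/esym/near_eq_jacobian.
    by apply: open_near_eq oTU _ Uy => z /Ff.
  exact: dT.
rewrite (Ff _ Uy) -(prolong_comp (df _ Uy) dB).
have dBf := differentiable_comp (df _ Uy) dB.
rewrite -(prolong_mulmx dA (dJ _ Uy)) -(prolong_mulmx (dJ _ Uy) dBf).
by apply: near_eq_prolong; exact: open_near_eq oU _ Uy.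
Qed.

End Prolongation.

(** * Prolongation of an almost (para-)complex structure *)

Section Structure.
Context {R : realType}.

(** Since B anticommutes with the involution A, X = - A B / 2 solves
    A X + B = X A; conjugation by the unipotent matrix with upper right block X
    then removes B. *)
Lemma rank_eigenspace_block n (A B : 'M[R]_n) a :
  A *m A = 1%:M -> A *m B + B *m A = 0 ->
  \rank (eigenspace (block_mx A B 0 A) a) = (\rank (eigenspace A a)).*2.
Proof.
move=> AA AB0; have BA : B *m A = - (A *m B) by apply/eqP; rewrite -addr_eq0 addrC AB0.
pose P : 'M[R]_(n + n) := block_mx 1%:M (- (2^-1 *: (A *m B))) 0 1%:M.
have uP : P \in unitmx by rewrite unitmxE det_ublock !det1 mulr1 unitr1.
pose C := A - a%:M.
have E : (block_mx A B 0 A - a%:M) *m P = P *m block_mx C 0 0 C.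
  rewrite (scalar_mx_block n n a) opp_block_mx add_block_mx !oppr0 !addr0.
  rewrite !mulmx_block !mul0mx !mulmx0 !mulmx1 !mul1mx !addr0 !add0r -/C.
  congr block_mx; rewrite /C mulmxN mulNmx mulmxBl mulmxBr.
  rewrite -scalemxAr -scalemxAl mulmxA AA mul1mx -mulmxA BA mulmxN mulmxA AA mul1mx.
  rewrite mul_scalar_mx mul_mx_scalar; set D := a *: _.
  rewrite scalerN !opprD !opprK addrAC; congr (_ + D).
  by rewrite -scaleNr -{2}[B]scale1r -scalerDl; congr (_ *: _); field.
have rE : \rank (block_mx A B 0 A - a%:M) = (\rank C).*2.
  rewrite -(@mxrankMfree _ _ _ _ _ P) ?row_free_unit // E.
  by rewrite (eqmxMfull _ _) ?row_full_unit // rank_diag_block_mx addnn.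
by rewrite /eigenspace !mxrank_ker rE -/C addnn doubleB.
Qed.

Lemma structure_prolong k m n (U : set 'rV[R]_m) (A : 'rV[R]_m -> 'M[R]_n)
    (y : 'rV[R]_(m + m)) :
  open U -> U (lsubmx y) -> differentiable A (lsubmx y) ->
  (forall x, U x -> structure_matrix k (A x)) ->
  structure_matrix k (prolong A y).
Proof.
move=> oU Uy dA sA.
have sq (e : 'M[R]_n) : (forall x, U x -> A x *m A x = e) ->
    prolong A y *m prolong A y = block_mx e 0 0 e.
  move=> AA; rewrite -prolong_mulmx // -(prolong_cst _ y); apply: near_eq_prolong.
  exact: open_near_eq oU _ Uy.
case: k sA => /= sA.
  by rewrite (sq _ sA) scalar_mx_block opp_block_mx !oppr0.
have AA := sq _ (fun x Ux => (sA x Ux).1).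
split; first by rewrite AA -scalar_mx_block.
(* The upper right block of the squared matrix is the derivative of A *m A. *)
have [Ay rk] := sA _ Uy; move: AA; rewrite mulmx_block.
move=> /eq_block_mx[_ AB _ _].
by rewrite !rank_eigenspace_block // rk.
Qed.

End Structure.

(** * The complete lift *)

Section CompleteLift.
Context {R : realType} {n : nat} {M : manifold R n}.
Implicit Types (J : tensor11 M) (xi : tangent_bundle M).

Definition chart_comp J (i : atlas_index M) (x : 'rV[R]_n) : 'M[R]_n :=
  J i (cinv (atlas i) x).

Lemma chart_compE J i p : cdom (atlas i) p -> chart_comp J i (cmap (atlas i) p) = J i p.
Proof. by move=> ip; rewrite /chart_comp cmapK. Qed.

Lemma chart_comp_diff J i p : cdom (atlas i) p ->
  differentiable (chart_comp J i) (cmap (atlas i) p).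
Proof. by move=> ip; apply: smooth_diff (tensor_smooth J i) _; exists p. Qed.

Definition lift_comp J (i : atlas_index (tangent_bundle M)) xi : 'M[R]_(n + n) :=
  prolong (chart_comp J i) (cmap (atlas i) xi).

Lemma lift_comp_smooth J i :
  smooth (cmap (atlas i) @` cdom (atlas i))
         (fun y => lift_comp J i (cinv (atlas i) y)).
Proof.
move=> k; have := Ck_prolong (@cimg_open _ _ _ (@atlas R n M i)) (tensor_smooth J i k.+1).
rewrite -timgE; apply: Ck_eq => [|y iy]; first exact: timg_open.
by rewrite /lift_comp cinvK.
Qed.

(** The transition maps of the tangent bundle are the tangent maps of those of M,
    so this is the prolongation of the transformation law of J. *)
Lemma lift_comp_change J i j xi : cdom (atlas i) xi -> cdom (atlas j) xi ->
  lift_comp J i xi *m 'J (transition (atlas i) (atlas j)) (cmap (atlas i) xi) =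
  'J (transition (atlas i) (atlas j)) (cmap (atlas i) xi) *m lift_comp J j xi.
Proof.
move=> ip jp; pose c := @atlas R n M i; pose d := @atlas R n M j.
have E : transition (atlas i) (atlas j) (cmap (atlas i) xi) = cmap (atlas j) xi.
  by rewrite /transition /in_charts cmapK.
have fE p : cdom c p -> transition c d (cmap c p) = cmap d p.
  by move=> cp; rewrite /transition /in_charts cmapK.
rewrite {2}/lift_comp -E.
apply: (@prolong_intertwine _ _ _ (overlap c d) (transition c d)).
- exact: overlap_open.
- exact: atlas_compatible.
- move=> z Uz; transitivity (@tmap _ _ M j (@tinv _ _ M i z)) => //.
  rewrite ttransitionE ?toverlapE // /tangent_fun.
  rewrite deriveEjacobian //; exact: (smooth_diff (@atlas_compatible _ _ M i j) Uz).
- move=> _ [p [cp dp] <-]; rewrite fE //.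
  by rewrite !chart_compE //; exact: tensor_change.
- by rewrite row_mxKl; exists (foot xi).
- by rewrite row_mxKl; exact: chart_comp_diff.
- by rewrite row_mxKl fE //; exact: chart_comp_diff.
Qed.

Definition lift_tensor J : tensor11 (tangent_bundle M) :=
  Tensor11 (lift_comp_smooth J) (@lift_comp_change J).

Lemma lift_structureP k (J : almost_structure k M) i xi : cdom (atlas i) xi ->
  structure_matrix k (lift_tensor J i xi).
Proof.
move=> ip; apply: (@structure_prolong _ k n n _ _ _ (@cimg_open _ _ _ (@atlas R n M i))).
- by rewrite row_mxKl; exists (foot xi).
- by rewrite row_mxKl; exact: chart_comp_diff.
- by move=> _ [p cp <-]; rewrite chart_compE //; exact: structure_tensorP.
Qed.

Definition complete_lift k (J : almost_structure k M) :
    almost_structure k (tangent_bundle M) :=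
  AlmostStructure (@lift_structureP k J).

End CompleteLift.

(** * Naturality *)

Section Naturality.
Context {R : realType} {n : nat} {M N : manifold R n} (f : smooth_map M N).

Lemma in_charts_tangent_map (i : atlas_index M) (j : atlas_index N)
    (y : 'rV[R]_(n + n)) :
  (cmap (atlas i) @` (cdom (atlas i) `&` f @^-1` cdom (atlas j))) (lsubmx y) ->
  in_charts (@atlas _ _ (tangent_bundle M) i) (@atlas _ _ (tangent_bundle N) j)
    (tangent_map f) y =
  tangent_fun (in_charts (atlas i) (atlas j) f) y.
Proof.
move=> [p [ip jp] py].
have pE : cinv (atlas i) (lsubmx y) = p by rewrite -py cmapK.
transitivity (@tmap _ _ N j (tangent_map f (@tinv _ _ M i y))) => //.
have fE : foot (@tinv _ _ M i y) = p by [].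
have cE : component (@tinv _ _ M i y) i = rsubmx y.
  by apply: component_tangent_of; rewrite pE.
rewrite /tmap foot_tangent_map (comp_tangent_map (i := i)) fE // cE py.
rewrite /tangent_fun deriveEjacobian; first by rewrite /in_charts pE.
by rewrite -py; exact: smooth_map_diff.
Qed.

Lemma complete_lift_intertwines k (J : almost_structure k M) (K : almost_structure k N) :
  intertwines J K f ->
  intertwines (complete_lift J) (complete_lift K) (tangent_map f).
Proof.
move=> JK i j xi ip jp.
pose c := @atlas _ _ M i; pose d := @atlas _ _ N j.
pose U := cmap c @` (cdom c `&` f @^-1` cdom d).
have oU : open U.
  apply: open_img; apply: open_comp; last exact: cdom_open.
  by move=> p _; exact: smooth_fun_continuous.
have E : in_charts (atlas i) (atlas j) (tangent_map f) (cmap (atlas i) xi) =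
    cmap (atlas j) (tangent_map f xi) by rewrite /in_charts cmapK.
have fE p : cdom c p -> in_charts c d f (cmap c p) = cmap d (f p).
  by move=> cp; rewrite /in_charts cmapK.
rewrite /= /lift_comp -E.
apply: (@prolong_intertwine _ _ _ U (in_charts c d f) _ (chart_comp J i)
  (chart_comp K j)).
- exact: oU.
- exact: smooth_fun_in_charts.
- by move=> z Uz; rewrite in_charts_tangent_map.
- move=> _ [p [cp dp] <-]; rewrite (fE p cp).
  by rewrite (chart_compE J cp) (chart_compE K dp); exact: JK.
- by rewrite row_mxKl; exact: (ex_intro2 _ _ (foot xi) (conj ip jp) erefl).
- by rewrite row_mxKl; exact: (chart_comp_diff J ip).
- by rewrite row_mxKl (fE _ ip); exact: (chart_comp_diff K jp).
Qed.

End Naturality.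

(** * Integrability *)

(** The changes of coordinates with the charts of the atlas are transition maps
    composed with F, or with its inverse G. For F a tangent map, this produces
    charts of a tangent bundle without a new check of its topology. *)
Lemma rechart (R : realType) (m : nat) (N : manifold R m) (i : atlas_index N)
    (O O' : set 'rV[R]_m) (F G : 'rV[R]_m -> 'rV[R]_m) :
  open O -> open O' -> O `<=` cmap (atlas i) @` cdom (atlas i) ->
  (forall y, O y -> O' (F y) /\ G (F y) = y) ->
  (forall y, O' y -> O (G y) /\ F (G y) = y) ->
  smooth O F -> smooth O' G ->
  exists2 c : chart R m N, smooth_chart c &
    cdom c = cdom (atlas i) `&` cmap (atlas i) @^-1` O /\
    cmap c = F \o cmap (atlas i).
Proof.
move=> oO oO' Oi FO GO sF sG.
pose D := cdom (atlas i) `&` cmap (atlas i) @^-1` O.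
have oD : open D.
  rewrite openE => p [ip Op]; apply: (@filterI _ (nbhs p)).
    by apply: open_nbhs_nbhs; split => //; exact: cdom_open.
  by apply: (cmap_continuous ip); exact: open_nbhs_nbhs.
have imgD : (F \o cmap (atlas i)) @` D = O'.
  apply/seteqP; split => [_ [p [_ Op] <-]|y Oy]; first exact: (FO _ Op).1.
  have [OGy FGy] := GO _ Oy; have [p ip pE] := Oi _ OGy.
  by exists p; rewrite /D /= ?pE.
have oimg : open ((F \o cmap (atlas i)) @` D) by rewrite imgD.
have K p : D p -> (cinv (atlas i) \o G) ((F \o cmap (atlas i)) p) = p.
  by move=> [ip Op]; rewrite /= (FO _ Op).2 cmapK.
have Fc p : D p -> {for p, continuous (F \o cmap (atlas i))}.
  move=> [ip Op]; apply: continuous_comp; first exact: cmap_continuous.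
  exact: (sF 0%N).
have Gc y : ((F \o cmap (atlas i)) @` D) y -> {for y, continuous (cinv (atlas i) \o G)}.
  rewrite imgD => Oy; apply: continuous_comp; first exact: (sG 0%N).
  by apply: cinv_continuous; apply: Oi; exact: (GO _ Oy).1.
exists (Chart oD oimg K Fc Gc) => // j; set c := Chart _ _ _ _ _; split.
- apply: (@smooth_comp _ _ _ _ _ _ O (transition (atlas j) (atlas i)) F) => //.
  + exact: overlap_open.
  + by move=> _ [p [jp [ip Op]] <-]; rewrite /transition /in_charts cmapK.
  + apply: smooth_sub (atlas_compatible j i) => _ [p [jp [ip _]] <-].
    by exists p.
- apply: (@smooth_comp _ _ _ _ _ _ (overlap (atlas i) (atlas j)) G
    (transition (atlas i) (atlas j))) => //; last exact: atlas_compatible.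
  + exact: overlap_open.
  + by move=> _ [p [[ip Op] jp] <-]; rewrite /= (FO _ Op).2; exists p.
  + by apply: smooth_sub sG => _ [p [[ip Op] _] <-]; exact: (FO _ Op).1.
Qed.

(** Let J be constant in the chart c. The chart induced by c on the tangent bundle
    is obtained from a chart of its atlas by applying the tangent map of the
    transition to c. There the matrix of the lift is the prolongation of a
    constant function. *)
Lemma complete_lift_integrable (R : realType) (n : nat) (k : structure_kind)
    (M : manifold R n) (J : almost_structure k M) :
  integrable J -> integrable (complete_lift J).
Proof.
move=> iJ xi0; have [c [sc cp [A JA]]] := iJ (foot xi0).
have [i ip] := atlas_cover (foot xi0).
pose phi := transition (atlas i) c; pose psi := transition c (atlas i).
pose V := overlap (atlas i) c; pose V' := overlap c (atlas i).
have oV : open V by exact: overlap_open.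
have oV' : open V' by exact: overlap_open.
have [sphi spsi] := sc i.
have phiV x : V x -> V' (phi x) /\ psi (phi x) = x.
  move=> [p [ip' cp'] <-]; rewrite /psi /phi /transition /in_charts !cmapK //.
  by split => //; exists p.
have psiV x : V' x -> V (psi x) /\ phi (psi x) = x.
  move=> [p [cp' ip'] <-]; rewrite /psi /phi /transition /in_charts !cmapK //.
  by split => //; exists p.
(* By the chain rule, tangent maps of mutually inverse maps are mutually inverse. *)
have inv W W' (f g : 'rV[R]_n -> 'rV[R]_n) : open W -> smooth W f -> smooth W' g ->
    (forall x, W x -> W' (f x) /\ g (f x) = x) ->
    forall y : 'rV[R]_(n + n), W (lsubmx y) ->
    W' (lsubmx (tangent_fun f y)) /\ tangent_fun g (tangent_fun f y) = y.
  move=> oW sf sg fW y Wy; have [W'fy _] := fW _ Wy.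
  split; first by rewrite row_mxKl.
  rewrite -(tangent_fun_comp (smooth_diff sf Wy) (smooth_diff sg W'fy)).
  rewrite -[RHS]tangent_fun_id; apply: near_eq_tangent_fun.
  by apply: open_near_eq oW _ Wy => x /fW[].
have [|c' sc' [cd cm]] := @rechart _ _ (tangent_bundle M) i
  [set y | V (lsubmx y)] [set y | V' (lsubmx y)] (tangent_fun phi) (tangent_fun psi)
  (open_lsubmx oV) (open_lsubmx oV') _ (inv _ _ _ _ oV sphi spsi phiV)
  (inv _ _ _ _ oV' spsi sphi psiV) (fun l => Ck_tangent_fun oV (sphi l.+1))
  (fun l => Ck_tangent_fun oV' (spsi l.+1)).
  by rewrite timgE => y [p [ip' _] yE]; exists p.
exists c'; split => //.
  by rewrite cd; split => //=; rewrite row_mxKl; exists (foot xi0).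
exists (block_mx A 0 0 A) => i' xi ip' /=; rewrite cd => -[ix [p [ipp cpp]]].
rewrite row_mxKl => pE.
pose a := @atlas _ _ M i; pose a' := @atlas _ _ M i'.
have {}ix : cdom a (foot xi) by [].
have {}ip' : cdom a' (foot xi) by [].
have {p pE cpp ipp} cx : cdom c (foot xi) by rewrite -(cmapK ix) -pE cmapK.
pose U := cmap a' @` (cdom a' `&` (cdom a `&` cdom c)).
have oU : open U by apply: open_img; apply: openI; exact: cdom_open.
have s1 : smooth U (transition a' a).
  by apply: smooth_sub (@atlas_compatible _ _ M i' i) => _ [p [i'p [ip1 _]] <-]; exists p.
have s2 : smooth U (transition a' c).
  by apply: smooth_sub (sc i').1 => _ [p [i'p [_ cp1]] <-]; exists p.
rewrite -(prolong_cst A (transition (atlas i') c' (cmap (atlas i') xi))).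
apply: (@prolong_intertwine _ _ _ U (transition a' c)) => //.
- move=> z Uz; rewrite /transition /in_charts cm /=.
  have -> : @tmap _ _ M i (@tinv _ _ M i' z) = tangent_fun (transition a' a) z.
    rewrite ttransitionE; last first.
      by rewrite toverlapE; case: Uz => p [i'p [ip1 _]] pz; exists p.
    by rewrite /tangent_fun deriveEjacobian //; exact: smooth_diff s1 Uz.
  rewrite -tangent_fun_comp; [|exact: smooth_diff s1 Uz|].
    apply: near_eq_tangent_fun; apply: open_near_eq oU _ Uz.
    by move=> _ [p [i'p [ip1 cp1]] <-]; rewrite /phi /transition /in_charts !cmapK.
  apply: smooth_diff sphi _; case: Uz => p [i'p [ip1 cp1]] <-.
  by rewrite /transition /in_charts cmapK //; exists p.
- by move=> _ [p [i'p [ip1 cp1]] <-]; rewrite (chart_compE J i'p) //; exact: JA.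
- by rewrite row_mxKl; exists (foot xi).
- by rewrite row_mxKl; exact: (chart_comp_diff J ip').
Qed.

Theorem proposition1 (R : realType) (n : nat) (k : structure_kind) :
  exists lift : forall M : manifold R n,
      almost_structure k M -> almost_structure k (tangent_bundle M),
    canonical_lift lift /\
    forall (M : manifold R n) (J : almost_structure k M),
      integrable J -> integrable (lift M J).
Proof.
exists (fun M J => complete_lift J); split => [M N J K f _|M J].
  exact: complete_lift_intertwines.
exact: complete_lift_integrable.
Qed.
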